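(* Let $\omega\in\Omega$ be such that $0<c_{\mathrm{s}}^\omega(x,y)<\infty$ for all $(x,y)\in\vec{E}_d$ and $\mu^{(2),\omega}(x)<\infty$ for all $x\in\mathbb{Z}^d$. Let $B$ be a finite non-empty subset of $\mathbb{Z}^d$ and let $\eta:\mathbb{Z}^d\to\mathbb{R}$ satisfy $$\operatorname{supp}\eta\subset B,\qquad 0\le\eta\le1,\qquad \eta\equiv0\ \text{ on }\partial B .$$ Suppose $u:\mathbb{Z}^d\to\mathbb{R}$ is either non-negative and $L^\omega$-subharmonic on $B$ (i.e. $-L^\omega u\le0$ on $B$), or $L^\omega$-harmonic on $B$ (i.e. $L^\omega u=0$ on $B$). Then for every $p\in[1,\infty]$ there exists a constant $C_{\mathrm{En}}\in(0,\infty)$, not depending on $\omega,B,\eta,u$, such that $$\frac{\mathcal{E}^\omega_\Gamma(\eta u)}{|B|}\;\le\;C_{\mathrm{En}}\,\bigl\|\mu^{(2),\omega}\bigr\|_{p,B}\,\bigl\|\nabla\eta\bigr\|^2_{\ell_\infty(E)}\,\bigl\|u^2\bigr\|_{p_*,B},$$ where $p_*=p/(p-1)$ is the Hölder conjugate of $p$.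
   Context: Lattice and cycles. Let $|\cdot|$ be the Euclidean norm on $\mathbb{Z}^d$ ($d\ge2$), $\mathcal{N}=\{z\in\mathbb{Z}^d:|z|=1\}$ and $\vec{E}_d=\{(x,y):|x-y|=1\}$. An oriented cycle $\vec\gamma$ of length $|\vec\gamma|=n$ based at $x_0$ is a finite sequence $(v_0,\dots,v_n)$ with $v_0=v_n=x_0$, $(v_{j-1},v_j)\in\vec{E}_d$, and $v_0,\dots,v_{n-1}$ mutually distinct. Write $x\in\vec\gamma$ if $x$ is one of the $v_j$, and $(x,y)\in\vec\gamma$ if $(x,y)$ is one of the oriented edges $(v_{j-1},v_j)$; $z+\vec\gamma$ is the shifted cycle. Let $\Gamma_0=\{\vec\gamma_i:i\in\mathbb{N}\}$ be a fixed collection of oriented cycles of finite length based at $0$ such that $\{x:\exists\,\vec\gamma\in\Gamma_0 \text{ with } (0,x)\in\vec\gamma\text{ or }(x,0)\in\vec\gamma\}=\mathcal{N}$, and let $\Gamma=\{x+\vec\gamma:\vec\gamma\in\Gamma_0,x\in\mathbb{Z}^d\}$. Weights. $\Omega=[0,\infty)^{\Gamma_0\times\mathbb{Z}^d}$; for $\omega\in\Omega$, the cycle $x+\vec\gamma$ ($\vec\gamma\in\Gamma_0$, $x\in\mathbb{Z}^d$) has weight $\omega(x+\vec\gamma)=\omega_{\vec\gamma}(x)$. Define $$c^\omega(x,y)=\sum_{\vec\gamma\in\Gamma}\omega(\vec\gamma)\mathbf{1}_{(x,y)\in\vec\gamma},\quad c^\omega_{\mathrm{s}}(x,y)=\tfrac12(c^\omega(x,y)+c^\omega(y,x)),\quad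 \mu^{(2),\omega}(x)=\sum_{\vec\gamma\in\Gamma}\omega(\vec\gamma)|\vec\gamma|^2\mathbf{1}_{x\in\vec\gamma},$$ and $(L^\omega f)(x)=\sum_y c^\omega(x,y)(f(y)-f(x))$. Dirichlet form. For finitely supported $f,g:\mathbb{Z}^d\to\mathbb{R}$, $\mathcal{E}^\omega_\Gamma(f,g)=\sum_{\vec\gamma\in\Gamma}\omega(\vec\gamma)\sum_{(x,y)\in\vec\gamma}f(x)(g(x)-g(y))$ and $\mathcal{E}^\omega_\Gamma(f)=\mathcal{E}^\omega_\Gamma(f,f)$. Further notation. $\partial B=\{x\in B:\exists\,y\notin B,\ |x-y|=1\}$ is the inner vertex boundary of $B$ (for a box $B=\{x:\|x-x_0\|_\infty\le r\}$ this is $\{x:\|x-x_0\|_\infty=\lfloor r\rfloor\}$). $\|\nabla\eta\|_{\ell_\infty(E)}=\sup_{(x,y)\in\vec{E}_d}|\eta(y)-\eta(x)|$. Space-averaged norms: $\|f\|_{p,B}=\bigl(\frac1{|B|}\sum_{x\in B}|f(x)|^p\bigr)^{1/p}$ for $p\in(0,\infty)$ and $\|f\|_{\infty,B}=\sup_{x\in B}|f(x)|$. *)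

(* Defs.v *)
From mathcomp Require Import all_boot all_order all_algebra.
From mathcomp Require Import finmap.
From mathcomp Require Import all_classical all_reals all_analysis.

Set Implicit Arguments.
Unset Strict Implicit.
Unset Printing Implicit Defensive.

Import Order.TTheory GRing.Theory Num.Theory.

Local Open Scope classical_set_scope.
Local Open Scope ring_scope.

(* Z^d is the type 'rV[int]_d. *)

Definition eucl_norm (R : realType) (d : nat) (x : 'rV[int]_d) : R :=
  Num.sqrt (\sum_(i < d) ((x ord0 i)%:~R : R) ^+ 2).

Definition adj (R : realType) (d : nat) : rel 'rV[int]_d :=
  fun x y => eucl_norm R (x - y) == 1.

(* A cycle (v_0, ..., v_n) is the sequence of its n + 1 vertices, base point
   included at both ends; its length is n. *)
Definition cycle_length (d : nat) (g : seq 'rV[int]_d) : nat := (size g).-1.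

Definition oriented_cycle (R : realType) (d : nat) (x0 : 'rV[int]_d)
    (g : seq 'rV[int]_d) : bool :=
  [&& ohead g == Some x0, last x0 g == x0, sorted (adj R (d := d)) g
    & uniq (take (cycle_length g) g)].

(* [:: (v_0, v_1); ...; (v_(n-1), v_n)] *)
Definition cycle_edges (d : nat) (g : seq 'rV[int]_d) :
  seq ('rV[int]_d * 'rV[int]_d) := zip g (behead g).

Definition shift_cycle (d : nat) (z : 'rV[int]_d) (g : seq 'rV[int]_d) :
  seq 'rV[int]_d := [seq z + v | v <- g].

(* The standing assumptions on Gamma_0. Countability is automatic, since
   seq 'rV[int]_d is countable. *)
Definition base_cycles (R : realType) (d : nat) (G0 : set (seq 'rV[int]_d)) :
    Prop :=
  (forall g, G0 g -> oriented_cycle R 0 g) /\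
  [set x | exists2 g, G0 g &
     ((0, x) \in cycle_edges g) || ((x, 0) \in cycle_edges g)]
  = [set x | eucl_norm R x = 1].

(* Omega = [0, oo[ ^ (Gamma_0 x Z^d): w g x is the weight of the cycle x + g;
   the values of w outside Gamma_0 play no role. *)
Definition weights (R : realType) (d : nat) (G0 : set (seq 'rV[int]_d))
    (w : seq 'rV[int]_d -> 'rV[int]_d -> R) : Prop :=
  forall g x, G0 g -> 0 <= w g x.

(* Sums over Gamma = {x + g : g in Gamma_0, x in Z^d} are indexed by the pairs
   (g, x). This indexing is one-to-one: the base point of x + g is x. *)
Definition cycle_index (d : nat) (G0 : set (seq 'rV[int]_d)) :
  set (seq 'rV[int]_d * 'rV[int]_d) := G0 `*` setT.

Definition cond (R : realType) (d : nat) (G0 : set (seq 'rV[int]_d))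
    (w : seq 'rV[int]_d -> 'rV[int]_d -> R) (x y : 'rV[int]_d) : \bar R :=
  \esum_(k in cycle_index G0)
    (w k.1 k.2 * ((x, y) \in cycle_edges (shift_cycle k.2 k.1))%:R)%:E.

Definition cond_sym (R : realType) (d : nat) (G0 : set (seq 'rV[int]_d))
    (w : seq 'rV[int]_d -> 'rV[int]_d -> R) (x y : 'rV[int]_d) : \bar R :=
  ((2^-1)%:E * (cond G0 w x y + cond G0 w y x))%E.

Definition mu2 (R : realType) (d : nat) (G0 : set (seq 'rV[int]_d))
    (w : seq 'rV[int]_d -> 'rV[int]_d -> R) (x : 'rV[int]_d) : \bar R :=
  \esum_(k in cycle_index G0)
    (w k.1 k.2 * (cycle_length (shift_cycle k.2 k.1))%:R ^+ 2
     * (x \in shift_cycle k.2 k.1)%:R)%:E.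

(* The sum over y in Z^d has finite support, as cond G0 w x y vanishes unless
   y is one of the 2d neighbours of x; fine is harmless as soon as all the
   conductances are finite. *)
Definition gen (R : realType) (d : nat) (G0 : set (seq 'rV[int]_d))
    (w : seq 'rV[int]_d -> 'rV[int]_d -> R) (f : 'rV[int]_d -> R)
    (x : 'rV[int]_d) : R :=
  \sum_(y \in [set: 'rV[int]_d]) fine (cond G0 w x y) * (f y - f x).

(* esum is only meaningful for non-negative families: a signed, absolutely
   summable family is summed as positive part minus negative part. *)
Definition signed_esum (R : realType) (T : choiceType) (D : set T)
    (a : T -> R) : \bar R :=
  (\esum_(k in D) (Num.max (a k) 0)%:E - \esum_(k in D) (Num.max (- a k) 0)%:E)%E.

Definition dirichlet2 (R : realType) (d : nat) (G0 : set (seq 'rV[int]_d))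
    (w : seq 'rV[int]_d -> 'rV[int]_d -> R) (f g : 'rV[int]_d -> R) : \bar R :=
  signed_esum (cycle_index G0)
    (fun k => w k.1 k.2 *
       \sum_(e <- cycle_edges (shift_cycle k.2 k.1)) f e.1 * (g e.1 - g e.2)).

Definition dirichlet (R : realType) (d : nat) (G0 : set (seq 'rV[int]_d))
    (w : seq 'rV[int]_d -> 'rV[int]_d -> R) (f : 'rV[int]_d -> R) : \bar R :=
  dirichlet2 G0 w f f.

Definition inner_boundary (R : realType) (d : nat) (B : {fset 'rV[int]_d}) :
  set 'rV[int]_d := [set x | x \in B /\ exists2 y, y \notin B & adj R x y].

Definition grad_sup (R : realType) (d : nat) (f : 'rV[int]_d -> R) : \bar R :=
  ereal_sup [set (`|f e.2 - f e.1|)%:E |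
    e in [set e : 'rV[int]_d * 'rV[int]_d | adj R e.1 e.2]].

(* Space-averaged norm, meaningful for p in ]0, oo] and B nonempty only. *)
Definition avg_norm (R : realType) (d : nat) (p : \bar R)
    (B : {fset 'rV[int]_d}) (f : 'rV[int]_d -> \bar R) : \bar R :=
  match p with
  | r%:E => ((((#|` B|)%:R^-1)%:E * \sum_(x <- B) (`|f x| `^ r)) `^ r^-1)%E
  | +oo%E => ereal_sup [set `|f x|%E | x in [set x | x \in B]]
  | -oo%E => 0%E
  end.

(* Main.v *)
Require Import Defs.
From mathcomp Require Import all_boot all_order all_algebra.
From mathcomp Require Import finmap.
From mathcomp Require Import all_classical all_reals all_analysis.
From mathcomp Require Import ring lra.

(** Why the energy estimate holds.  Write f = eta * u and let D be the largest
    increment of eta along an edge.  On one cycle of length n, with edges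
    e = (x, y), expanding the energy gives
      sum_e f(x) (f(x) - f(y))
        = sum_e eta(x)^2 u(x) (u(x) - u(y))
          + sum_e (eta(x) - eta(y)) eta(x) u(x) u(y).
    Summed over all cycles with their weights, the first part becomes
    - sum_x eta(x)^2 u(x) (L u)(x), which is nonpositive by (sub)harmonicity.

    The second part is first order in the increments of eta, and it cannot be
    symmetrised because only one orientation of each edge is present.  The
    remedy is that the increments of eta sum to zero around a cycle, so any
    constant may be subtracted from the other factor.  Let m be the minimum of
    eta on the cycle.  Split eta(x) = (eta(x) - m) + m.  The first summand is at
    most n D and contributes a term of order n D^2 sum u^2.  The second one
    leaves the factor m u(x) u(y), from which m u(z)^2 is subtracted, z being a
    vertex where |u| is minimal; the difference is controlled because
    m |u(x) - u(y)| is at most |f(x) - f(y)| + D |u(y)| on each edge.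
    Cauchy-Schwarz and Young's inequality absorb the gradient of f in the
    left-hand side and cost a factor n^2: this is where the
    weights n^2 of mu2 come from.  The result is cycle_caccioppoli, with the
    absolute constant 14.

    Summing over the cycles (dirichlet_le, through esum_le_combination) bounds
    the Dirichlet form by 14 D^2 sum_B mu2 u^2, and Hoelder's inequality for
    averages over B (avg_hoelder) finishes the proof.

    A cycle may leave B, where nothing is known on u.  Since eta vanishes on
    the inner boundary of B, every neighbour of a point of the support of eta
    lies in B; hence u may be replaced by its restriction to B without
    changing f, or L u on the support of eta. *)

Set Implicit Arguments.
Unset Strict Implicit.
Unset Printing Implicit Defensive.

Import Order.TTheory GRing.Theory Num.Theory.

Local Open Scope classical_set_scope.
Local Open Scope ring_scope.

(** * Sums along paths *)

Lemma le_of_eq (d : Order.disp_t) (T : porderType d) (x y : T) :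
  x = y -> (x <= y)%O.
Proof. by move->. Qed.

Lemma telescope_path (V : zmodType) (T : eqType) (f : T -> V) x s :
  \sum_(e <- zip (x :: s) s) (f e.1 - f e.2) = f x - f (last x s).
Proof.
elim: s x => [|y s IH] x /=; first by rewrite big_nil subrr.
by rewrite big_cons IH /= addrA subrK.
Qed.

(** Around a closed path each vertex is left as often as it is entered. *)
Lemma sum_edge_sources (V : zmodType) (T : eqType) (f : T -> V) x s :
  last x s = x ->
  \sum_(e <- zip (x :: s) s) f e.2 = \sum_(e <- zip (x :: s) s) f e.1.
Proof.
move=> sx; apply/esym/eqP; rewrite -subr_eq0 -sumrB telescope_path sx.
by rewrite subrr.
Qed.

Lemma path_variation (R : realDomainType) (T : eqType) (f : T -> R) x s y z :
  y \in x :: s -> z \in x :: s ->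
  `|f y - f z| <= \sum_(e <- zip (x :: s) s) `|f e.1 - f e.2|.
Proof.
have root t r v : v \in t :: r ->
    `|f t - f v| <= \sum_(e <- zip (t :: r) r) `|f e.1 - f e.2|.
  elim: r t => [|t' r IH] t /=.
    by rewrite inE => /eqP->; rewrite subrr normr0 big_nil.
  rewrite big_cons /= inE => /predU1P[->|/IH vr].
    rewrite subrr normr0 addr_ge0// sumr_ge0// => e _; exact: normr_ge0.
  by apply: le_trans (ler_distD (f t') _ _) _; rewrite lerD2l.
elim: s x y z => [|x' s IH] x y z.
  by rewrite !inE => /eqP-> /eqP->; rewrite subrr normr0 big_nil.
rewrite inE => /predU1P[->|ys] zs; first exact: root.
move: zs; rewrite inE => /predU1P[->|zs].
  by rewrite distrC; apply: root; rewrite inE ys orbT.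
rewrite [zip _ _]/= big_cons.
by apply: le_trans (IH _ _ _ ys zs) _; rewrite lerDr normr_ge0.
Qed.

Lemma sqr_sum_le (R : realDomainType) (I : Type) (r : seq I) (b : I -> R) :
  (\sum_(i <- r) b i) ^+ 2 <= (size r)%:R * \sum_(i <- r) b i ^+ 2.
Proof.
elim: r => [|i r IH]; first by rewrite !big_nil mulr0 expr0n.
rewrite !big_cons /=.
have cross : 2 * b i * \sum_(j <- r) b j <=
    (size r)%:R * b i ^+ 2 + \sum_(j <- r) b j ^+ 2.
  have -> : (size r)%:R * b i ^+ 2 = \sum_(j <- r) b i ^+ 2.
    by rewrite big_const_seq count_predT iter_addr addr0 mulr_natl.
  rewrite mulr_sumr -big_split ler_sum//= => j _.
  by have := sqr_ge0 (b i - b j); nra.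
by rewrite -natr1; lra.
Qed.

Lemma ex_argmin (d : Order.disp_t) (R : orderType d) (T : eqType)
    (f : T -> R) x s :
  exists2 z, z \in x :: s & forall y, y \in x :: s -> (f z <= f y)%O.
Proof.
elim: s x => [|x' s IH] x; first by exists x; rewrite ?inE// => y /[!inE]/eqP->.
have [z zs zmin] := IH x'; have [xz|/ltW zx] := leP (f x) (f z).
  exists x; rewrite ?inE ?eqxx// => y; rewrite inE => /predU1P[->//|/zmin].
  exact: le_trans.
exists z; first by rewrite inE zs orbT.
by move=> y; rewrite inE => /predU1P[->//|/zmin].
Qed.

Lemma mem_edge (T : eqType) (x : T) s e :
  e \in zip (x :: s) s -> (e.1 \in x :: s) && (e.2 \in x :: s).
Proof.
elim: s x => [|y s IH] x //; rewrite [zip _ _]/= in_cons.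
case/predU1P => [->|/IH/andP[e1 e2]]; first by rewrite /= !inE !eqxx orbT.
by rewrite !(in_cons x) e1 e2 !orbT.
Qed.

Lemma sum_over_support (R : pzRingType) (T : eqType) (s r : seq T)
    (phi : T -> R) :
  uniq s -> uniq r -> (forall v, v \in s -> v \notin r -> phi v = 0) ->
  \sum_(v <- s) phi v = \sum_(v <- r) (v \in s)%:R * phi v.
Proof.
move=> us ur supp.
transitivity (\sum_(v <- s | v \in r) phi v).
  rewrite [RHS]big_mkcond /= !big_seq; apply: eq_bigr => v vs.
  by case: ifPn => // /(supp _ vs).
transitivity (\sum_(v <- r | v \in s) phi v).
  rewrite -[LHS]big_filter -[RHS]big_filter; apply: perm_big; apply: uniq_perm.
  - exact: filter_uniq.
  - exact: filter_uniq.
  - by move=> v; rewrite !mem_filter andbC.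
rewrite big_mkcond; apply: eq_bigr => v _.
by case: (v \in s); rewrite ?mul1r ?mul0r.
Qed.

(** The Dirichlet form of one cycle is not symmetric, but its quadratic form
    is that of the unoriented cycle. *)
Lemma closed_path_energy (R : comPzRingType) (T : eqType) (f : T -> R) x s :
  last x s = x ->
  2 * \sum_(e <- zip (x :: s) s) f e.1 * (f e.1 - f e.2) =
  \sum_(e <- zip (x :: s) s) (f e.1 - f e.2) ^+ 2.
Proof.
move=> sx; have fsrc := sum_edge_sources (fun y => f y ^+ 2) sx.
transitivity (\sum_(e <- zip (x :: s) s)
    (2 * (f e.1 * (f e.1 - f e.2)) + (f e.2 ^+ 2 - f e.1 ^+ 2))).
  by rewrite big_split /= sumrB fsrc subrr addr0 -mulr_sumr.
by apply: eq_bigr => e _; ring.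
Qed.

(** * The energy inequality on a single cycle *)

(** Where eta >= m, the increments of u are controlled by those of eta * u:
    eta(x) (u(x) - u(y)) is the increment of eta * u on the edge (x, y), up to
    the error (eta(x) - eta(y)) u(y). *)
Lemma weighted_oscillation (R : realFieldType) (T : eqType) (eta u : T -> R)
    (m D : R) x s y z : last x s = x -> 0 <= m ->
  (forall v, v \in x :: s -> m <= eta v) ->
  (forall e, e \in zip (x :: s) s -> `|eta e.1 - eta e.2| <= D) ->
  y \in x :: s -> z \in x :: s ->
  m * `|u y - u z| <=
    \sum_(e <- zip (x :: s) s) `|eta e.1 * u e.1 - eta e.2 * u e.2|
    + D * \sum_(e <- zip (x :: s) s) `|u e.1|.
Proof.
move=> sx m0 eta_m etaD ys zs; set E := zip _ _.
apply: le_trans (_ : m * \sum_(e <- E) `|u e.1 - u e.2| <= _).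
  by rewrite ler_wpM2l//; exact: path_variation.
rewrite -(sum_edge_sources (fun v => `|u v|) sx).
rewrite !mulr_sumr -big_split /= !big_seq ler_sum// => e eE.
have /andP[e1 e2] := mem_edge eE.
apply: le_trans (_ : `|eta e.1 * (u e.1 - u e.2)| <= _).
  rewrite normrM ler_wpM2r// ger0_norm ?eta_m//.
  by apply: le_trans m0 _; exact: eta_m.
have -> : eta e.1 * (u e.1 - u e.2) =
  (eta e.1 * u e.1 - eta e.2 * u e.2) - (eta e.1 - eta e.2) * u e.2 by ring.
apply: le_trans (ler_normB _ _) _; rewrite lerD2l normrM ler_wpM2r//.
exact: etaD.
Qed.

(** The second term on the right is quadratic in the length of the cycle.  One
    factor n comes from bounding an oscillation by the sum of n increments, the
    other one from Cauchy-Schwarz over the n edges. *)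
Lemma cycle_caccioppoli (R : realFieldType) (T : eqType) (eta u : T -> R)
    (D : R) x s : last x s = x -> 0 <= D -> (forall y, 0 <= eta y) ->
  (forall e, e \in zip (x :: s) s -> `|eta e.1 - eta e.2| <= D) ->
  \sum_(e <- zip (x :: s) s)
     eta e.1 * u e.1 * (eta e.1 * u e.1 - eta e.2 * u e.2)
  <= 2 * \sum_(e <- zip (x :: s) s) eta e.1 ^+ 2 * u e.1 * (u e.1 - u e.2)
     + 14 * D ^+ 2 * ((size s)%:R ^+ 2 * \sum_(e <- zip (x :: s) s) u e.1 ^+ 2).
Proof.
move=> sx D0 eta0 etaD.
set E := zip _ _; set n : R := (size s)%:R.
have sizeE : size E = size s by rewrite size2_zip /=.
pose f y := eta y * u y.
set A := \sum_(e <- E) _; set I := \sum_(e <- E) _; set U := \sum_(e <- E) _.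
have [z0 z0s z0min] := ex_argmin eta x s.
have [z zs zmin] := ex_argmin (fun y => `|u y|) x s.
set m := eta z0.
have m0 : 0 <= m by exact: eta0.
pose F := \sum_(e <- E) `|f e.1 - f e.2|.
pose S := \sum_(e <- E) `|u e.1|.
have n0 : 0 <= n by exact: ler0n.
have S0 : 0 <= S by apply: sumr_ge0.
have F0 : 0 <= F by apply: sumr_ge0.
have U0 : 0 <= U by apply: sumr_ge0 => e _; exact: sqr_ge0.
have AE : 2 * A = \sum_(e <- E) `|f e.1 - f e.2| ^+ 2.
  rewrite /A /E (closed_path_energy f sx).
  by apply: eq_bigr => e _; rewrite real_normK ?num_real.
have A0 : 0 <= A.
  by rewrite -(pmulr_rge0 _ (ltr0n R 2)) AE sumr_ge0// => e _; exact: sqr_ge0.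
have FE : F ^+ 2 <= n * (2 * A).
  by rewrite AE /n -sizeE; exact: sqr_sum_le.
have SU : S ^+ 2 <= n * U.
  rewrite /n -sizeE; apply: le_trans (sqr_sum_le _ _) _.
  by rewrite ler_wpM2l// ler_sum// => e _; rewrite real_normK ?num_real.
have etan y : y \in x :: s -> eta y - m <= n * D.
  move=> ys; apply: le_trans (ler_norm _) _.
  apply: le_trans (path_variation eta ys z0s) _.
  rewrite -/E (_ : n * D = \sum_(e <- E) D).
    by rewrite !big_seq ler_sum.
  by rewrite big_const_seq count_predT iter_addr addr0 sizeE mulr_natl.
have mu y : y \in x :: s -> m * `|u y - u z| <= F + D * S.
  by move=> ys; exact: weighted_oscillation.
pose T' := F + D * S.
have T0 : 0 <= T' by rewrite addr_ge0// mulr_ge0.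
have main : A <= I + (n * D ^+ 2 * U + 2 * D * T' * S).
  (* The increments of eta sum to zero, so the constant m * u z ^+ 2 can be
     inserted in front of them. *)
  have -> : A = I + \sum_(e <- E) (eta e.1 - eta e.2) *
      ((eta e.1 - m) * (u e.1 * u e.2) + m * (u e.1 * u e.2 - u z ^+ 2)).
    have tele : \sum_(e <- E) (eta e.1 - eta e.2) * (m * u z ^+ 2) = 0.
      by rewrite -mulr_suml telescope_path sx subrr mul0r.
    rewrite -[LHS]subr0 -[X in _ - X = _]tele -sumrB -big_split /=.
    by apply: eq_bigr => e _; ring.
  rewrite lerD2l.
  have -> : n * D ^+ 2 * U + 2 * D * T' * S = \sum_(e <- E)
     (n * D ^+ 2 * (2^-1 * (u e.1 ^+ 2 + u e.2 ^+ 2)) + 2 * D * T' * `|u e.1|).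
    rewrite big_split /= -!mulr_sumr; congr (_ * _ + _).
    rewrite big_split /= (sum_edge_sources (fun y => u y ^+ 2) sx).
    rewrite -/E -/U; lra.
  rewrite !big_seq ler_sum// => e eE.
  have /andP[e1 e2] := mem_edge eE.
  set a := eta e.1 - eta e.2.
  have aD : `|a| <= D by exact: etaD.
  rewrite mulrDr; apply: lerD.
    apply: le_trans (ler_norm _) _; rewrite normrM normrM.
    have ez0 : 0 <= eta e.1 - m by rewrite subr_ge0 z0min.
    rewrite (ger0_norm ez0).
    apply: le_trans (_ : D * (n * D * (2^-1 * (u e.1 ^+ 2 + u e.2 ^+ 2))) <= _).
      apply: ler_pM => //; first by rewrite mulr_ge0.
      apply: ler_pM => //; first exact: etan.
      have := sqr_ge0 (`|u e.1| - `|u e.2|).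
      rewrite sqrrB !real_normK ?num_real// normrM -mulr_natl; lra.
    apply: le_of_eq; ring.
  apply: le_trans (ler_norm _) _; rewrite normrM.
  apply: le_trans (_ : D * (2 * T' * `|u e.1|) <= _); last first.
    apply: le_of_eq; ring.
  apply: ler_pM => //.
  have -> : m * (u e.1 * u e.2 - u z ^+ 2) =
    u e.1 * (m * (u e.2 - u z)) + u z * (m * (u e.1 - u z)) by ring.
  apply: le_trans (ler_normD _ _) _.
  have -> : 2 * T' * `|u e.1| = `|u e.1| * T' + `|u e.1| * T' by ring.
  apply: lerD; rewrite !normrM (ger0_norm m0).
    by rewrite ler_wpM2l// mu.
  apply: ler_pM => //; first by rewrite mulr_ge0.
    exact: zmin.
  exact: mu.
(* Young's inequality in the form 4 a b <= (a + b)^2, with a = A / 2: half of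
   the energy is then absorbed in the left-hand side. *)
have young : 2 * D * F * S <= A / 2 + 4 * n ^+ 2 * D ^+ 2 * U.
  have Y0 : 0 <= A / 2 + 4 * n ^+ 2 * D ^+ 2 * U.
    by rewrite addr_ge0 ?divr_ge0// !mulr_ge0// sqr_ge0.
  rewrite -ler_sqr ?nnegrE//; last by rewrite !mulr_ge0.
  apply: le_trans (_ : (2 * D) ^+ 2 * (n * (2 * A) * (n * U)) <= _).
    rewrite -[2 * D * F * S]mulrA [X in X <= _]exprMn ler_wpM2l ?sqr_ge0//.
    by rewrite exprMn ler_pM ?sqr_ge0.
  rewrite -subr_ge0.
  apply: le_trans (sqr_ge0 (A / 2 - 4 * n ^+ 2 * D ^+ 2 * U)) _.
  by apply: le_of_eq; field.
have : D ^+ 2 * S ^+ 2 <= D ^+ 2 * (n * U) by rewrite ler_wpM2l ?sqr_ge0.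
have : n * (D ^+ 2 * U) <= n ^+ 2 * (D ^+ 2 * U).
  rewrite ler_wpM2r ?mulr_ge0 ?sqr_ge0// /n -natrX ler_nat.
  by case: (size s) => // k; rewrite leq_pmulr.
move: main young; rewrite /T'; set X := A; set X' := I; lra.
Qed.

(** * Sums over infinite families *)

Lemma esumZl (R : realType) (T : choiceType) (I : set T) (c : R)
    (a : T -> \bar R) : 0 <= c -> (forall i, I i -> (0 <= a i)%E) ->
  \esum_(i in I) (c%:E * a i)%E = (c%:E * \esum_(i in I) a i)%E.
Proof.
move=> c0 a0.
have le_scale b (g : T -> \bar R) : 0 <= b -> (forall i, I i -> (0 <= g i)%E) ->
    (\esum_(i in I) (b%:E * g i) <= b%:E * \esum_(i in I) g i)%E.
  move=> b0 g0; apply: ge_ereal_sup => _ [X [finX XI] <-].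
  rewrite fsbig_finite//= big_seq -ge0_sume_distrr -?big_seq; last first.
    by move=> i; rewrite in_fset_set// inE => /XI/g0.
  rewrite lee_wpmul2l ?lee_fin// esum_ge//; exists X => //.
  by rewrite fsbig_finite.
apply/eqP; rewrite eq_le le_scale//=.
have [->|cn0] := eqVneq c 0.
  by rewrite mul0e esum_ge0// => i Ii; rewrite mul0e.
have cp : 0 < c by rewrite lt_neqAle eq_sym cn0.
rewrite -lee_pdivlMl//.
have -> : \esum_(i in I) a i = \esum_(i in I) (c^-1%:E * (c%:E * a i))%E.
  by apply: eq_esum => i _; rewrite muleA -EFinM mulVf// mul1e.
apply: le_scale; first by rewrite invr_ge0.
by move=> i /a0 ai; rewrite mule_ge0// lee_fin.
Qed.

(** The coefficients h j may have any sign, while esum is additive only on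
    nonnegative families: the negative part of the combination is moved to the
    left-hand side before summing, and back afterwards. *)
Lemma esum_le_combination (R : realType) (T J : choiceType) (I : set T)
    (r : seq J) (h : J -> R) (c : J -> T -> R) (a : T -> R) :
  (forall k, I k -> 0 <= a k) -> (forall j k, I k -> 0 <= c j k) ->
  (forall j, j \in r -> (\esum_(k in I) (c j k)%:E < +oo)%E) ->
  (forall k, I k -> a k <= \sum_(j <- r) h j * c j k) ->
  (\esum_(k in I) (a k)%:E <=
     (\sum_(j <- r) h j * fine (\esum_(k in I) (c j k)%:E))%:E)%E.
Proof.
move=> a0 c0 cfin ale.
pose hp j := Num.max (h j) 0; pose hn j := Num.max (- h j) 0.
have hp0 j : 0 <= hp j by rewrite le_max lexx orbT.
have hn0 j : 0 <= hn j by rewrite le_max lexx orbT.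
have hE j : h j = hp j - hn j.
  by rewrite /hp /hn; case: (leP (h j)); case: (leP (- h j)); lra.
have scaled g : (forall j, 0 <= g j) ->
    \esum_(k in I) (\sum_(j <- r) (g j * c j k)%:E)%E
    = (\sum_(j <- r) g j * fine (\esum_(k in I) (c j k)%:E))%:E.
  move=> g0; rewrite esum_sum; last first.
    by move=> k j Ik _; rewrite lee_fin mulr_ge0// c0.
  rewrite -sumEFin !big_seq; apply: eq_bigr => j jr.
  under eq_esum do rewrite EFinM.
  rewrite esumZl//; last by move=> k Ik; rewrite lee_fin c0.
  rewrite EFinM fineK// ge0_fin_numE ?cfin//.
  by apply: esum_ge0 => k Ik; rewrite lee_fin c0.
have : (\esum_(k in I) ((a k)%:E + \sum_(j <- r) (hn j * c j k)%:E) <=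
        \esum_(k in I) (\sum_(j <- r) (hp j * c j k)%:E))%E.
  apply: le_esum => k Ik; rewrite !sumEFin -EFinD lee_fin -lerBrDr -sumrB.
  apply: le_trans (ale _ Ik) _; apply: le_of_eq.
  by apply: eq_bigr => j _; rewrite hE mulrBl.
rewrite esumD.
- rewrite !scaled// -leeBrDr// -EFinB -sumrB => /le_trans; apply.
  rewrite lee_fin; apply: le_of_eq.
  by apply: eq_bigr => j _; rewrite hE mulrBl.
- by move=> k Ik; rewrite lee_fin a0.
- by move=> k Ik; rewrite sume_ge0// => j _; rewrite lee_fin mulr_ge0// c0.
Qed.

(** * Hoelder's inequality for averages *)

(** Young's inequality, averaged after dividing f and g by their norms. *)
Lemma avg_hoelder_powR (R : realType) (T : eqType) (r : seq T) (p q : R)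
    (f g : T -> R) : r != [::] -> 0 < p -> 0 < q -> p^-1 + q^-1 = 1 ->
  (forall x, 0 <= f x) -> (forall x, 0 <= g x) ->
  (size r)%:R^-1 * \sum_(x <- r) f x * g x <=
    ((size r)%:R^-1 * \sum_(x <- r) f x `^ p) `^ p^-1 *
    ((size r)%:R^-1 * \sum_(x <- r) g x `^ q) `^ q^-1.
Proof.
move=> r0 p0 q0 pq f0 g0; set N : R := (size r)%:R.
have N0 : 0 < N by rewrite ltr0n lt0n size_eq0.
have vanish s (h : T -> R) : 0 < s -> (forall x, 0 <= h x) ->
    (N^-1 * \sum_(x <- r) h x `^ s) `^ s^-1 = 0 -> forall x, x \in r -> h x = 0.
  move=> s0 h0 /powR_eq0_eq0 /eqP; rewrite mulf_eq0 invr_eq0 gt_eqF//=.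
  rewrite psumr_eq0 => [/allP hr x /hr/eqP/powR_eq0_eq0//|x _].
  exact: powR_ge0.
have power s (h : T -> R) : 0 < s ->
    ((N^-1 * \sum_(x <- r) h x `^ s) `^ s^-1) `^ s
    = N^-1 * \sum_(x <- r) h x `^ s.
  move=> s0; rewrite -powRrM mulVf ?gt_eqF// powRr1// mulr_ge0//.
    by rewrite invr_ge0 ltW.
  by apply: sumr_ge0 => x _; exact: powR_ge0.
(* From here on only the p-th and q-th powers of the two norms, and what their
   vanishing implies, matter. *)
have a0 := vanish p f p0 f0; have b0 := vanish q g q0 g0.
have ap := power p f p0; have bq := power q g q0.
have a_ge0 := powR_ge0 (N^-1 * \sum_(x <- r) f x `^ p) p^-1.
have b_ge0 := powR_ge0 (N^-1 * \sum_(x <- r) g x `^ q) q^-1.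
move: (_ `^ p^-1) (_ `^ q^-1) => a b in a0 b0 ap bq a_ge0 b_ge0 *.
have [{}/a0 a0|an0] := eqVneq a 0.
  rewrite big_seq big1 ?mulr0 ?mulr_ge0// => x xr.
  by rewrite a0// mul0r.
have [{}/b0 b0|bn0] := eqVneq b 0.
  rewrite big_seq big1 ?mulr0 ?mulr_ge0// => x xr.
  by rewrite b0// mulr0.
have a_gt0 : 0 < a by rewrite lt_neqAle eq_sym an0.
have b_gt0 : 0 < b by rewrite lt_neqAle eq_sym bn0.
have ab_gt0 : 0 < a * b by exact: mulr_gt0.
suff : \sum_(x <- r) (a * b)^-1 * (f x * g x) <= N.
  rewrite -mulr_sumr => sumN.
  by rewrite (ler_pdivrMl _ _ N0) [N * _]mulrC -(ler_pdivrMl _ _ ab_gt0).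
apply: le_trans (_ : \sum_(x <- r)
    ((f x / a) `^ p / p + (g x / b) `^ q / q) <= _).
  apply: ler_sum => x _; rewrite (_ : _ * (f x * g x) = f x / a * (g x / b)).
    by apply: conjugate_powR => //; rewrite divr_ge0// ltW.
  by field; rewrite an0 bn0.
have normalized s c (h : T -> R) : 0 < s -> 0 < c -> (forall x, 0 <= h x) ->
    c `^ s = N^-1 * \sum_(x <- r) h x `^ s ->
    \sum_(x <- r) (h x / c) `^ s / s = N / s.
  move=> s0 c0 h0 cE; rewrite -mulr_suml; congr (_ / _).
  under eq_bigr do rewrite powRM ?invr_ge0 ?(ltW c0)//.
  rewrite -mulr_suml (_ : \sum_(x <- r) _ = N * c `^ s).
    by rewrite -mulrA -powRM ?invr_ge0 ?(ltW c0)// divff ?gt_eqF// powR1 mulr1.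
  by rewrite cE mulrA divff ?mul1r// gt_eqF.
rewrite big_split /= !normalized//.
by rewrite -mulrDr pq mulr1.
Qed.

Lemma avg_norm1 (R : realType) (d : nat) (B : {fset 'rV[int]_d})
    (f : 'rV[int]_d -> R) : (forall x, 0 <= f x) ->
  avg_norm 1%E B (EFin \o f) =
  ((#|` B|%:R^-1)%:E * \sum_(x <- B) (f x)%:E)%E.
Proof.
move=> f0; rewrite /avg_norm /=.
under eq_bigr => x _ do rewrite powRr1// ger0_norm//.
rewrite invr1 poweRe1// mule_ge0 ?lee_fin ?invr_ge0//.
by rewrite sume_ge0// => x _; rewrite lee_fin.
Qed.

Lemma avg_hoelder1y (R : realType) (d : nat) (B : {fset 'rV[int]_d})
    (f g : 'rV[int]_d -> R) : (forall x, 0 <= f x) -> (forall x, 0 <= g x) ->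
  ((#|` B|%:R^-1 * \sum_(x <- B) f x * g x)%:E <=
   avg_norm +oo%E B (EFin \o f) * avg_norm 1%E B (EFin \o g))%E.
Proof.
move=> f0 g0; rewrite avg_norm1// muleCA EFinM lee_wpmul2l ?lee_fin ?invr_ge0//.
rewrite ge0_sume_distrr; last by move=> x _; rewrite lee_fin.
rewrite -sumEFin !big_seq; apply: lee_sum => x xB.
rewrite EFinM lee_wpmul2r ?lee_fin//; apply: ereal_sup_ubound.
by exists x => //=; rewrite ger0_norm.
Qed.

Lemma avg_hoelder (R : realType) (d : nat) (B : {fset 'rV[int]_d})
    (p : \bar R) (f g : 'rV[int]_d -> R) : B != fset0 -> (1 <= p)%E ->
  (forall x, 0 <= f x) -> (forall x, 0 <= g x) ->
  ((#|` B|%:R^-1 * \sum_(x <- B) f x * g x)%:E <=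
   avg_norm p B (EFin \o f) * avg_norm (hoelder_conjugate p) B (EFin \o g))%E.
Proof.
move=> B0 p1 f0 g0; case: p p1 => [p||]//; last first.
  by move=> _; rewrite hoelder_conjugatey; exact: avg_hoelder1y.
rewrite lee_fin le_eqVlt => /predU1P[<-|p1].
  rewrite hoelder_conjugate1 muleC.
  by under eq_bigr do rewrite mulrC; exact: avg_hoelder1y.
have p0 : 0 < p by apply: lt_trans p1.
set q := p / (p - 1).
have q0 : 0 < q by rewrite divr_gt0// subr_gt0.
have -> : hoelder_conjugate p%:E = q%:E.
  by rewrite /hoelder_conjugate/= eqe gt_eqF// inver subr_eq0 gt_eqF.
have pq : p^-1 + q^-1 = 1 by rewrite /q; field; rewrite !gt_eqF ?subr_gt0.
have r0 : (B : seq _) != [::] by rewrite -size_eq0 cardfs_eq0.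
rewrite /avg_norm /= !sumEFin -!EFinM lee_fin.
have absE (h : 'rV[int]_d -> R) s : (forall x, 0 <= h x) ->
    \sum_(x <- B) `|h x| `^ s = \sum_(x <- B) h x `^ s.
  by move=> h0; apply: eq_bigr => x _; rewrite ger0_norm.
rewrite !absE//; exact: avg_hoelder_powR.
Qed.

(** * Cycles of the lattice *)

Lemma oriented_cycle_cons (R : realType) (d : nat) (x0 : 'rV[int]_d) s :
  oriented_cycle R x0 (x0 :: s) =
  [&& last x0 s == x0, path (adj R (d := d)) x0 s & uniq (belast x0 s)].
Proof.
rewrite /oriented_cycle /cycle_length /= eqxx /=; do 2!congr (_ && _).
by rewrite lastI -cats1 take_size_cat ?size_belast.
Qed.

Lemma shift_oriented_cycle (R : realType) (d : nat) (z : 'rV[int]_d) g :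
  oriented_cycle R 0 g ->
  exists s, [/\ shift_cycle z g = z :: s, last z s = z,
    path (adj R (d := d)) z s & uniq (belast z s)].
Proof.
move=> cg; case: g cg (cg) => [|x s] /and4P[]//= /eqP[->] _ _ _.
rewrite oriented_cycle_cons => /and3P[/eqP sx ps us].
exists [seq z + v | v <- s]; rewrite addr0.
have last_shift : last z [seq z + v | v <- s] = z.
  by rewrite -[X in last X]addr0 last_map sx addr0.
have path_shift : path (adj R (d := d)) z [seq z + v | v <- s].
  rewrite -[X in path _ X]addr0 path_map; apply: sub_path ps => v w.
  by rewrite /adj /= opprD addrACA subrr add0r.
by split => //; rewrite -[X in belast X]addr0 belast_map map_inj_uniq.
Qed.

Lemma unzip1_edges (T : Type) (x : T) s :
  [seq e.1 | e <- zip (x :: s) s] = belast x s.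
Proof. by elim: s x => //= y s IH x; rewrite IH. Qed.

Lemma path_edge (T : eqType) (r : rel T) (x : T) s e :
  path r x s -> e \in zip (x :: s) s -> r e.1 e.2.
Proof.
elim: s x => // y s IH x /andP[xy ps].
by rewrite [zip _ _]/= in_cons => /predU1P[->//|/IH]; exact.
Qed.

Lemma adj_delta (R : realType) (d : nat) (i : 'I_d) :
  adj R (delta_mx ord0 i) 0.
Proof.
rewrite /adj subr0 /eucl_norm (bigD1 i)//= big1 ?addr0.
  by rewrite mxE !eqxx expr1n sqrtr1.
by move=> j ji; rewrite mxE (negbTE ji) andbF expr0n.
Qed.

(** The supremum is a real number: it is at most 1 since eta takes its values
    in [0, 1], and it is not -oo since the lattice has at least one edge. *)
Lemma grad_supP (R : realType) (d : nat) (eta : 'rV[int]_d -> R) :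
  (0 < d)%N -> (forall x, 0 <= eta x <= 1) ->
  exists D : R, [/\ grad_sup eta = D%:E, 0 <= D &
    forall x y, adj R x y -> `|eta x - eta y| <= D].
Proof.
move=> d0 eta01.
have ub x y : adj R x y -> (`|eta y - eta x|%:E <= grad_sup eta)%E.
  by move=> xy; apply: ereal_sup_ubound; exists (x, y).
have g0 : (0 <= grad_sup eta)%E.
  by apply: le_trans (ub _ _ (adj_delta R (Ordinal d0))); rewrite lee_fin.
have g1 : (grad_sup eta <= 1)%E.
  apply: ge_ereal_sup => _ [[x y] _ <-] /=; rewrite lee_fin ler_norml.
  by have /andP[] := eta01 x; have /andP[] := eta01 y; lra.
have gfin : grad_sup eta \is a fin_num.
  by rewrite ge0_fin_numE// (le_lt_trans g1)// ltry.
exists (fine (grad_sup eta)); split; first by rewrite fineK.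
  exact: fine_ge0.
by move=> x y /ub; rewrite -lee_fin fineK// distrC.
Qed.

Lemma mem_edge_adj (R : realType) (d : nat) (G0 : set (seq 'rV[int]_d)) k e :
  base_cycles R G0 -> cycle_index G0 k ->
  e \in cycle_edges (shift_cycle k.2 k.1) -> adj R e.1 e.2.
Proof.
move=> [G0cycle _] [/G0cycle/(shift_oriented_cycle k.2) [s [-> _ ps _]] _].
exact: path_edge.
Qed.

Lemma cond_eq0 (R : realType) (d : nat) (G0 : set (seq 'rV[int]_d))
    (w : seq 'rV[int]_d -> 'rV[int]_d -> R) x y :
  base_cycles R G0 -> ~~ adj R x y -> cond G0 w x y = 0%E.
Proof.
move=> G0cycle xy; apply: esum1 => k Ik.
case: (boolP (_ \in _)) => [/(mem_edge_adj G0cycle Ik)/=|_].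
  by rewrite (negbTE xy).
by rewrite mulr0.
Qed.

Lemma gen_fin (R : realType) (d : nat) (G0 : set (seq 'rV[int]_d))
    (w : seq 'rV[int]_d -> 'rV[int]_d -> R) (B : {fset 'rV[int]_d}) u x :
  base_cycles R G0 -> (forall y, adj R x y -> y \in B) ->
  gen G0 w u x = \sum_(y <- B) fine (cond G0 w x y) * (u y - u x).
Proof.
move=> G0cycle nbrs; rewrite /gen [RHS]fsbig_seq ?fset_uniq//.
rewrite [RHS](fsbig_widen _ setT)// => y [_ /= yB].
by rewrite cond_eq0 ?mul0r//; apply: contra_notN yB => /nbrs.
Qed.

(** The sums along a cycle are rewritten as sums over B with the membership
    indicators of the cycle, so that summing over the cycles produces the
    conductances and mu2. The vertices of a cycle are distinct, hence each
    vertex and each edge of B is met at most once. *)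
Lemma cycle_energy_le (R : realType) (d : nat) (G0 : set (seq 'rV[int]_d))
    (B : {fset 'rV[int]_d}) (eta u : 'rV[int]_d -> R) (D : R) k c :
  c = shift_cycle k.2 k.1 -> base_cycles R G0 -> cycle_index G0 k ->
  (forall x, 0 <= eta x) -> 0 <= D ->
  (forall x y, adj R x y -> `|eta x - eta y| <= D) ->
  (forall x, x \notin B -> u x = 0) ->
  (forall x y, eta x != 0 -> adj R x y -> y \in B) ->
  \sum_(e <- cycle_edges c)
     eta e.1 * u e.1 * (eta e.1 * u e.1 - eta e.2 * u e.2) <=
  \sum_(e <- [seq (x, y) | x <- B, y <- B])
     2 * (eta e.1 ^+ 2 * u e.1 * (u e.1 - u e.2)) * (e \in cycle_edges c)%:R +
  \sum_(x <- B)
     14 * D ^+ 2 * u x ^+ 2 * ((cycle_length c)%:R ^+ 2 * (x \in c)%:R).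
Proof.
move=> cE G0cycle Ik eta0 D0 etaD uB inB.
have := mem_edge_adj G0cycle Ik; rewrite -cE.
case: (G0cycle) => G0c _; have [/G0c/(shift_oriented_cycle k.2)] := Ik.
rewrite -cE => -[s [{cE}-> sx ps us]] _ cadj.
have /le_trans := cycle_caccioppoli u sx D0 eta0
  (fun e eE => etaD _ _ (cadj e eE)).
apply; apply: lerD.
  rewrite (sum_over_support (r := [seq (x, y) | x <- B, y <- B])).
  - rewrite mulr_sumr; apply: le_of_eq.
    by apply: eq_bigr => e _; ring.
  - by apply: (@map_uniq _ _ fst); rewrite unzip1_edges.
  - by rewrite allpairs_uniq ?fset_uniq// => -[? ?] [? ?].
  - move=> -[x y] /cadj /= xy; apply: contraNeq; rewrite !mulf_eq0 !negb_or.
    case/andP => /andP[/andP[ex _] ux] _.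
    apply/allpairsP; exists (x, y); split => //=.
      by apply: contraNT ux => /uB ->.
    exact: inB xy.
have -> : \sum_(e <- zip (k.2 :: s) s) u e.1 ^+ 2 =
    \sum_(v <- belast k.2 s) u v ^+ 2 by rewrite -unzip1_edges big_map.
rewrite (sum_over_support us (fset_uniq B)); last first.
  by move=> v _ /uB ->; rewrite expr0n.
rewrite 2!mulr_sumr; apply: ler_sum => v _.
have -> : 14 * D ^+ 2 * u v ^+ 2 *
    ((cycle_length (k.2 :: s))%:R ^+ 2 * (v \in k.2 :: s)%:R) =
  14 * D ^+ 2 * ((size s)%:R ^+ 2 * ((v \in k.2 :: s)%:R * u v ^+ 2)).
  by rewrite /cycle_length /=; ring.
rewrite -!mulrA ler_wpM2l// !ler_wpM2l ?sqr_ge0// ler_wpM2r ?sqr_ge0//.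
by rewrite ler_nat; case: (boolP (v \in belast _ _)) => // /mem_belast ->.
Qed.

(** * Summation over the cycles *)

(** Each cycle has a nonnegative energy, so the signed sum is a plain one. *)
Lemma dirichlet_esum (R : realType) (d : nat) (G0 : set (seq 'rV[int]_d))
    (w : seq 'rV[int]_d -> 'rV[int]_d -> R) (f : 'rV[int]_d -> R) :
  base_cycles R G0 -> weights G0 w ->
  let a k := w k.1 k.2 *
    \sum_(e <- cycle_edges (shift_cycle k.2 k.1)) f e.1 * (f e.1 - f e.2) in
  (forall k, cycle_index G0 k -> 0 <= a k) /\
  dirichlet G0 w f = \esum_(k in cycle_index G0) (a k)%:E.
Proof.
move=> [G0c _] w0 a.
have a0 k : cycle_index G0 k -> 0 <= a k.
  move=> [kG _]; apply: mulr_ge0; first exact: w0.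
  have [s [-> sx _ _]] := shift_oriented_cycle k.2 (G0c _ kG).
  rewrite -(pmulr_rge0 _ (ltr0n R 2)) closed_path_energy// sumr_ge0// => e _.
  exact: sqr_ge0.
split=> //; rewrite /dirichlet /dirichlet2 /signed_esum.
rewrite [X in (_ - X)%E]esum1 ?sube0; last first.
  by move=> k /a0 ak; rewrite max_r// oppr_le0.
by apply: eq_esum => k /a0 ak; rewrite max_l.
Qed.

(** Here u already vanishes off B, and the hypothesis on u * gen u is the common
    consequence of subharmonicity for nonnegative u and of harmonicity. *)
Lemma dirichlet_le (R : realType) (d : nat) (G0 : set (seq 'rV[int]_d))
    (w : seq 'rV[int]_d -> 'rV[int]_d -> R) (B : {fset 'rV[int]_d})
    (eta u : 'rV[int]_d -> R) (D : R) :
  base_cycles R G0 -> weights G0 w ->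
  (forall x y, adj R x y -> (cond G0 w x y < +oo)%E) ->
  (forall x, (mu2 G0 w x < +oo)%E) ->
  (forall x, 0 <= eta x) -> 0 <= D ->
  (forall x y, adj R x y -> `|eta x - eta y| <= D) ->
  (forall x, x \notin B -> u x = 0) ->
  (forall x y, eta x != 0 -> adj R x y -> y \in B) ->
  (forall x, x \in B -> eta x != 0 -> 0 <= u x * gen G0 w u x) ->
  (dirichlet G0 w (fun x => eta x * u x)%R <=
     (14 * D ^+ 2 * \sum_(x <- B) fine (mu2 G0 w x) * u x ^+ 2)%:E)%E.
Proof.
move=> G0c w0 cfin mufin eta0 D0 etaD uB inB ugen.
have [a0 ->] := dirichlet_esum (fun x => eta x * u x) G0c w0.
(* The edges and the vertices of B index one family of nonnegative terms: the
   sums of its two halves over the cycles are the conductances and mu2. *)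
pose V := 'rV[int]_d.
pose h (j : (V * V) + V) : R := match j with
  | inl e => 2 * (eta e.1 ^+ 2 * u e.1 * (u e.1 - u e.2))
  | inr x => 14 * D ^+ 2 * u x ^+ 2 end.
pose c (j : (V * V) + V) (k : seq V * V) : R := match j with
  | inl e => w k.1 k.2 * ((e.1, e.2) \in cycle_edges (shift_cycle k.2 k.1))%:R
  | inr x => w k.1 k.2 * (cycle_length (shift_cycle k.2 k.1))%:R ^+ 2
             * (x \in shift_cycle k.2 k.1)%:R end.
pose BB : seq (V * V) := [seq (x, y) | x <- B, y <- B].
pose r := map inl BB ++ map inr (B : seq V).
have := @esum_le_combination R _ _ (cycle_index G0) r h c _ a0.
have c0 j k : cycle_index G0 k -> 0 <= c j k.
  by move=> [/w0 wk _]; case: j => [e|x] /=; rewrite !mulr_ge0// sqr_ge0.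
have c1 j : (\esum_(k in cycle_index G0) (c j k)%:E < +oo)%E.
  case: j => [[x y]|x]; last exact: mufin.
  have [/cfin//|xy] := boolP (adj R x y).
  by rewrite -/(cond G0 w x y) cond_eq0 ?ltry.
move=> /(_ c0 (fun j _ => c1 j)) le_comb; apply: le_trans (le_comb _) _.
  move=> k Ik; have [/w0 wk _] := Ik.
  have := cycle_energy_le erefl G0c Ik eta0 D0 etaD uB inB.
  move=> /(ler_wpM2l (wk k.2))/le_trans; apply.
  rewrite /r big_cat !big_map /=; apply: le_of_eq.
  rewrite mulrDr !mulr_sumr; congr (_ + _).
    by apply: eq_bigr => -[x y] _ /=; ring.
  by apply: eq_bigr => x _; ring.
rewrite lee_fin /r big_cat !big_map /= -[leRHS]add0r; apply: lerD; last first.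
  rewrite mulr_sumr; apply: le_of_eq.
  by apply: eq_bigr => x _; rewrite -/(mu2 G0 w x); ring.
rewrite big_allpairs_dep /= big_seq sumr_le0// => x xB.
have [ex|ex] := eqVneq (eta x) 0.
  by rewrite big1// => y _; rewrite ex expr0n !(mul0r, mulr0).
have -> : \sum_(y <- B) 2 * (eta x ^+ 2 * u x * (u x - u y)) *
    fine (\esum_(k in cycle_index G0)
      (w k.1 k.2 * ((x, y) \in cycle_edges (shift_cycle k.2 k.1))%:R)%:E) =
    - (2 * eta x ^+ 2 * (u x * gen G0 w u x)).
  rewrite (gen_fin _ _ G0c (fun y => inB x y ex)) !mulr_sumr -sumrN.
  by apply: eq_bigr => y _; rewrite -/(cond G0 w x y); ring.
by rewrite oppr_le0 mulr_ge0 ?ugen// mulr_ge0 ?sqr_ge0.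
Qed.

(** * The energy estimate *)

Unset Implicit Arguments.

Theorem proposition4p3 (R : realType) (d : nat) (hd : (2 <= d)%N)
    (G0 : set (seq 'rV[int]_d)) (hG0 : base_cycles R G0)
    (p : \bar R) (hp : (1 <= p)%E) :
  exists C : R, 0 < C /\
    forall (w : seq 'rV[int]_d -> 'rV[int]_d -> R)
      (B : {fset 'rV[int]_d}) (eta u : 'rV[int]_d -> R),
      weights G0 w ->
      (forall x y, adj R x y -> (0 < cond_sym G0 w x y < +oo)%E) ->
      (forall x, (mu2 G0 w x < +oo)%E) ->
      B != fset0 ->
      (forall x, eta x != 0 -> x \in B) ->
      (forall x, 0 <= eta x <= 1) ->
      (forall x, inner_boundary R B x -> eta x = 0) ->
      ((forall x, x \in B -> 0 <= u x /\ - gen G0 w u x <= 0) \/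
       (forall x, x \in B -> gen G0 w u x = 0)) ->
      (dirichlet G0 w (fun x => (eta x * u x)%R) * ((#|` B|)%:R^-1)%:E
       <= C%:E * avg_norm p B (mu2 G0 w) * grad_sup eta ^+ 2
          * avg_norm (hoelder_conjugate p) B (fun x => ((u x) ^+ 2)%:E))%E.
Proof.
exists 14; split=> // w B eta u w0 cfin mufin B0 etaB eta01 eta_bd sub.
have eta0 x : 0 <= eta x by case/andP: (eta01 x).
have [D [gradE D0 etaD]] := grad_supP (ltnW hd) eta01.
have cond0 x y : (0 <= cond G0 w x y)%E.
  by apply: esum_ge0 => k [/w0 wk _]; rewrite lee_fin mulr_ge0.
have mu0 x : (0 <= mu2 G0 w x)%E.
  by apply: esum_ge0 => k [/w0 wk _]; rewrite lee_fin !mulr_ge0// sqr_ge0.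
have cfin' x y : adj R x y -> (cond G0 w x y < +oo)%E.
  move=> /cfin/andP[_]; apply: contraTT; rewrite -leNgt leye_eq => /eqP cy.
  rewrite /cond_sym cy addye; last first.
    by rewrite gt_eqF// (lt_le_trans ltNy0 (cond0 _ _)).
  by rewrite gt0_muley ?lte_fin ?invr_gt0.
have inB x y : eta x != 0 -> adj R x y -> y \in B.
  move=> ex xy; have xB := etaB x ex; apply: contraNT ex => yB.
  by apply/eqP/eta_bd; split => //; exists y.
pose v x := if x \in B then u x else 0.
have vB x : x \notin B -> v x = 0 by rewrite /v => /negbTE ->.
have -> : (fun x => eta x * u x) = (fun x => eta x * v x).
  apply/funext => x; rewrite /v; case: ifPn => // xB.
  by have [->|/etaB] := eqVneq (eta x) 0; rewrite ?mul0r// (negbTE xB).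
have vgen x : x \in B -> eta x != 0 -> 0 <= v x * gen G0 w v x.
  move=> xB ex; have -> : gen G0 w v x = gen G0 w u x.
    rewrite !(gen_fin _ _ hG0 (fun y => inB x y ex)) !big_seq.
    by apply: eq_bigr => y yB; rewrite /v xB yB.
  rewrite /v xB; case: sub => [/(_ _ xB)[ux]|->//]; last by rewrite mulr0.
  by rewrite oppr_le0; exact: mulr_ge0.
have muE : mu2 G0 w = EFin \o (fine \o mu2 G0 w).
  by apply/funext => x /=; rewrite fineK// ge0_fin_numE.
have hoelder := avg_hoelder B0 hp
  (fun x => fine_ge0 (mu0 x)) (fun x => sqr_ge0 (u x)).
have le_energy := dirichlet_le hG0 w0 cfin' mufin eta0 D0 etaD vB inB vgen.
apply: le_trans (lee_wpmul2r _ le_energy) _; first by rewrite lee_fin invr_ge0.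
apply: le_trans (_ : ((14 * D ^+ 2)%:E * (avg_norm p B (mu2 G0 w) *
   avg_norm (hoelder_conjugate p) B (fun x => (u x ^+ 2)%:E)) <= _)%E);
  last first.
  rewrite gradE -EFin_expe EFinM.
  apply: le_of_eq.
  by rewrite -!muleA; congr (_ * _)%E; rewrite muleCA.
rewrite -EFinM mulrAC -mulrA EFinM lee_wpmul2l ?lee_fin ?mulr_ge0 ?sqr_ge0//.
rewrite muE; apply: le_trans hoelder.
rewrite lee_fin !big_seq; apply: le_of_eq; congr (_ * _).
by apply: eq_bigr => x xB; rewrite /v xB.
Qed.
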